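(* Let $S$ be a group-embeddable semigroup, and let $T$ be a subsemigroup of finite Green index in $S$. Then $S$ has a finite Malcev presentation if and only if $T$ has a finite Malcev presentation.
   Context: For a semigroup $S$, $S^1=S\cup\{1\}$ denotes $S$ with a new identity element $1\notin S$ adjoined; for $X\subseteq S$, $X^1=X\cup\{1\}$. For a subsemigroup $T$ of $S$ and $u,v\in S$: $u\,\mathscr{R}^T v$ iff $uT^1=vT^1$; $u\,\mathscr{L}^T v$ iff $T^1u=T^1v$; $\mathscr{H}^T=\mathscr{R}^T\cap\mathscr{L}^T$. Each $\mathscr{H}^T$-class lies wholly in $T$ or wholly in $S\setminus T$. The Green index of $T$ in $S$ is one more than the number of $\mathscr{H}^T$-classes contained in $S\setminus T$. A congruence $\sigma$ on a semigroup $S$ is a Malcev congruence if $S/\sigma$ is embeddable in a group; intersections of Malcev congruences are Malcev congruences. For an alphabet $A$ and $\rho\subseteq A^+\times A^+$, $\rho^M$ denotes the smallest Malcev congruence on the free semigroup $A^+$ containing $\rho$. Then $\langle A\mid\rho\rangle$ is a Malcev presentation for any semigroup isomorphic to $A^+/\rho^M$; it is finite if both $A$ and $\rho$ are finite. *)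

(* Defs.v *)
From HB Require Import structures.
From mathcomp Require Import all_boot.
From mathcomp Require Import boolp classical_sets cardinality.

Set Implicit Arguments.
Unset Strict Implicit.
Unset Printing Implicit Defensive.

Local Open Scope classical_set_scope.
Local Open Scope group_scope.
Local Open Scope quotient_scope.
Local Open Scope card_scope.

Definition group_embeddable (S : semigroupType) : Prop :=
  exists (G : groupType) (f : {multiplicative S -> G}), injective f.

Definition semigroup_isomorphic (S T : semigroupType) : Prop :=
  exists f : {multiplicative S -> T}, bijective f.

(** The monoid S^1: the new identity [None] is adjoined even if S already has
    an identity. *)

Definition adj1 (S : Type) : Type := option S.

HB.instance Definition _ (S : choiceType) := Choice.on (adj1 S).

Section Adj1.
Variable S : semigroupType.

Definition adj1_mul (x y : adj1 S) : adj1 S :=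
  match x, y with
  | Some a, Some b => Some (a * b)
  | Some _, None => x
  | None, _ => y
  end.

Lemma adj1_mulA : associative adj1_mul.
Proof. by case=> [a|] [b|] [c|] //=; rewrite mulgA. Qed.

Lemma adj1_mul1g : left_id None adj1_mul.
Proof. by case. Qed.

Lemma adj1_mulg1 : right_id None adj1_mul.
Proof. by case. Qed.

HB.instance Definition _ :=
  isMonoid.Build (adj1 S) adj1_mulA adj1_mul1g adj1_mulg1.

Definition adj1_in (x : S) : adj1 S := Some x.

Definition adj1_set (X : set S) : set (adj1 S) :=
  (adj1_in @` X) `|` [set 1].

Variable T : set S.

Definition greenR (u v : S) : Prop :=
  [set adj1_in u * t | t in adj1_set T] = [set adj1_in v * t | t in adj1_set T].

Definition greenL (u v : S) : Prop :=
  [set t * adj1_in u | t in adj1_set T] = [set t * adj1_in v | t in adj1_set T].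

Definition greenH (u v : S) : Prop := greenR u v /\ greenL u v.

Definition greenH_class (u : S) : set S := [set v | greenH u v].

Definition outer_greenH_classes : set (set S) :=
  [set C | (exists u, C = greenH_class u) /\ C `<=` ~` T].

Definition has_green_index (n : nat) : Prop :=
  exists2 k, outer_greenH_classes #= `I_k & n = k.+1.

Definition finite_green_index : Prop := exists n, has_green_index n.

End Adj1.

Record congruence (S : semigroupType) := Congruence {
  cong_rel :> S -> S -> Prop;
  cong_refl : forall x, cong_rel x x;
  cong_sym : forall x y, cong_rel x y -> cong_rel y x;
  cong_trans : forall x y z, cong_rel x y -> cong_rel y z -> cong_rel x z;
  cong_mul : forall x x' y y',
    cong_rel x x' -> cong_rel y y' -> cong_rel (x * y) (x' * y')
}.

Section Quotient.
Variables (S : semigroupType) (sigma : congruence S).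

Definition cong_relb : rel S := fun x y => `[< sigma x y >].

Lemma cong_relb_equiv : equiv_class_of cong_relb.
Proof.
split=> [x|x y|y x z]; first exact/asboolP/cong_refl.
- by apply/idP/idP => /asboolP h; apply/asboolP/cong_sym.
- by move=> /asboolP xy /asboolP yz; apply/asboolP/(cong_trans xy).
Qed.

Canonical cong_equiv := EquivRelPack cong_relb_equiv.

Definition quotient_semigroup : Type := {eq_quot cong_equiv}.

HB.instance Definition _ := Choice.on quotient_semigroup.
HB.instance Definition _ := EqQuotient.on quotient_semigroup.

Definition quotient_proj (x : S) : quotient_semigroup :=
  \pi_quotient_semigroup x.

Lemma quotient_projP x y : quotient_proj x = quotient_proj y <-> sigma x y.
Proof. by split=> [/eqmodP/asboolP|h]; last exact/eqmodP/asboolP. Qed.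

Lemma quotient_reprK (a : quotient_semigroup) : quotient_proj (repr a) = a.
Proof. exact: reprK. Qed.

Definition quotient_mul (a b : quotient_semigroup) : quotient_semigroup :=
  quotient_proj (repr a * repr b).

Lemma quotient_projM x y :
  quotient_proj (x * y) = quotient_mul (quotient_proj x) (quotient_proj y).
Proof.
by apply/quotient_projP/cong_mul; apply/quotient_projP; rewrite quotient_reprK.
Qed.

Lemma quotient_mulA : associative quotient_mul.
Proof.
move=> a b c; rewrite -(quotient_reprK a) -(quotient_reprK b) -(quotient_reprK c).
by rewrite -!quotient_projM mulgA.
Qed.

HB.instance Definition _ := isSemigroup.Build quotient_semigroup quotient_mulA.

End Quotient.

Record word (A : Type) := Word { letters :> seq A; _ : ~~ nilp letters }.

HB.instance Definition _ (A : Type) := [isSub for @letters A].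
HB.instance Definition _ (A : choiceType) := [Choice of word A by <:].

Section FreeSemigroup.
Variable A : choiceType.

Lemma word_cat_subproof (u v : word A) : ~~ nilp (u ++ v).
Proof. by case: u => [[]]. Qed.

Definition word_cat (u v : word A) : word A := Word (word_cat_subproof u v).

Lemma word_catA : associative word_cat.
Proof. by move=> u v w; apply: val_inj; rewrite /= catA. Qed.

HB.instance Definition _ := isSemigroup.Build (word A) word_catA.

End FreeSemigroup.

Definition malcev (S : semigroupType) (sigma : congruence S) : Prop :=
  group_embeddable (quotient_semigroup sigma).

Section MalcevPresentation.
Variables (A : choiceType) (rho : set (word A * word A)).

Definition malcev_above (sigma : congruence (word A)) : Prop :=
  malcev sigma /\ forall p, rho p -> sigma p.1 p.2.

Definition malcev_hull_rel (u v : word A) : Prop :=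
  forall sigma, malcev_above sigma -> sigma u v.

(** This is rho^M: since intersections of Malcev congruences are Malcev, the
    intersection of all the Malcev congruences containing rho is the smallest
    one. *)
Definition malcev_hull : congruence (word A).
Proof.
apply: (@Congruence _ malcev_hull_rel).
- by move=> x sigma _; exact: cong_refl.
- by move=> x y xy sigma h; exact: cong_sym (xy _ h).
- by move=> x y z xy yz sigma h; exact: cong_trans (xy _ h) (yz _ h).
- by move=> x x' y y' xx yy sigma h; exact: cong_mul (xx _ h) (yy _ h).
Defined.

Definition malcev_presentation (S : semigroupType) : Prop :=
  semigroup_isomorphic (quotient_semigroup malcev_hull) S.

End MalcevPresentation.

Definition has_finite_malcev_presentation (S : semigroupType) : Prop :=
  exists (A : finType) (rho : set (word A * word A)),
    finite_set rho /\ malcev_presentation rho S.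

(* Main.v *)
From HB Require Import structures.
Require Import Defs.
From mathcomp Require Import all_boot.
From mathcomp Require Import boolp classical_sets cardinality.

(** Everything takes place inside a group G containing S, hence T.  Malcev
    congruences on a free semigroup are exactly the kernels of its maps to
    groups ([malcevP]), so S has a finite Malcev presentation if and only if it
    has a finite generating family and finitely many relations, true in S, such
    that every assignment of the generators into a group satisfying them
    satisfies all relations of S ([has_finite_malcev_presentationP]).

    A pigeonhole argument on powers then gives a dichotomy.  Suppose that some
    t in T has its inverse outside T.  If s t^i avoided T for more exponents i
    than there are outer classes, then two of these elements would be related,
    and cancelling would put t^-1 in T; hence a fixed power w of t satisfies
    S w, w S <= T ([nonunit_absorbs]).  In that case S and T have the same
    universal group: a morphism phi from T to a group extends to S by
    s |-> phi (s w) phi (w)^-1 ([fraction_morphism]), and this carries finite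
    systems of relations in both directions.  What remains is finite generation
    of T, obtained by rewriting a word of S first from the right with
    representatives of the relative R-classes and then from the left with
    representatives of the relative L-classes ([generation_sub]).

    Otherwise T is closed under inverses.  If T is nonempty it is a group, S is
    a finite union of its cosets and is a group as well.  Going up, the
    multiplication rules of coset representatives by generators complete a
    presentation of T ([finitely_presented_coset_up]).  Going down is the
    Reidemeister-Schreier theorem; an assignment k of the Schreier generators
    into a group K is turned into an action of S on G * K, the permutation
    form of the induced representation ([finitely_presented_coset_down]).
    If T is empty, S is a finite group or empty, and the trivial subgroup can
    replace T. *)

Set Implicit Arguments.
Unset Strict Implicit.
Unset Printing Implicit Defensive.

Local Open Scope group_scope.

(** * Words, relations and presentations inside a group *)

Definition value (G : groupType) (A : Type) (a : A -> G) (u : seq A) : G :=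
  \prod_(x <- u) a x.

Section Value.
Variables (G : groupType) (A : Type) (a : A -> G).

Lemma value_nil : value a [::] = 1.
Proof. exact: big_nil. Qed.

Lemma value_cons x u : value a (x :: u) = a x * value a u.
Proof. exact: big_cons. Qed.

Lemma value_cat u v : value a (u ++ v) = value a u * value a v.
Proof. exact: big_cat. Qed.

Lemma value1 x : value a [:: x] = a x.
Proof. by rewrite value_cons value_nil mulg1. Qed.

Lemma value_map (B : Type) (h : B -> A) u : value a (map h u) = value (a \o h) u.
Proof. exact: big_map. Qed.

Lemma eq_value (b : A -> G) : a =1 b -> value a =1 value b.
Proof. by move=> ab u; apply: eq_bigr => x _; apply: ab. Qed.

Lemma value_closed (S : set G) : (forall x y, S x -> S y -> S (x * y)) ->
  (forall x, S (a x)) -> forall u, u <> [::] -> S (value a u).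
Proof.
move=> SM Sa; elim=> [//|x [|y u] IH] _; first by rewrite value1.
by rewrite value_cons; apply: SM => //; apply: IH.
Qed.

End Value.

Lemma value_flatten (G : groupType) (A B : Type) (a : A -> G) (h : B -> seq A) u :
  value a (flatten (map h u)) = value (fun y => value a (h y)) u.
Proof.
elim: u => [|x u IH]; first by rewrite !value_nil.
by rewrite value_cons -IH -value_cat.
Qed.

Definition satisfies (G : groupType) (A : eqType) (a : A -> G)
    (rho : seq (seq A * seq A)) : Prop :=
  forall p, p \in rho -> value a p.1 = value a p.2.

Lemma satisfies_cat (G : groupType) (A : eqType) (a : A -> G) rho sigma :
  satisfies a (rho ++ sigma) <-> satisfies a rho /\ satisfies a sigma.
Proof.
split=> [h|[h1 h2] p]; last by rewrite mem_cat => /orP[/h1|/h2].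
by split=> p hp; apply: h; rewrite mem_cat hp ?orbT.
Qed.

Lemma satisfies_map (G : groupType) (A : eqType) (a : A -> G) (I : eqType)
    (F : I -> seq A * seq A) (s : seq I) :
  satisfies a (map F s) <-> forall i, i \in s -> value a (F i).1 = value a (F i).2.
Proof.
split=> [h i si|h p /mapP[i si ->]]; last exact: h.
by apply: h; apply: map_f.
Qed.

Lemma satisfies_flatten (G : groupType) (A : eqType) (a : A -> G) (I : eqType)
    (F : I -> seq (seq A * seq A)) (s : seq I) :
  satisfies a (flatten (map F s)) <-> forall i, i \in s -> satisfies a (F i).
Proof.
split=> [h i si p pF|h p /flatten_mapP[i si pF]]; last exact: h pF.
by apply: h; apply/flatten_mapP; exists i.
Qed.

(** Nonempty words: [S] is a semigroup, which may or may not contain 1. *)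
Definition generates (G : groupType) (A : Type) (a : A -> G) (S : set G) : Prop :=
  forall g, S g <-> exists2 u : seq A, u <> [::] & value a u = g.

(** The quantification over groups [K] replaces the least Malcev congruence.
    Empty words are allowed in relations: in a group, adding a common first
    letter to both sides of a relation does not change its meaning. *)
Definition presents (G : groupType) (A : eqType) (a : A -> G)
    (rho : seq (seq A * seq A)) : Prop :=
  satisfies a rho /\
  forall (K : groupType) (k : A -> K), satisfies k rho ->
  forall u v, value a u = value a v -> value k u = value k v.

Definition finitely_presented (G : groupType) (S : set G) : Prop :=
  exists (A : finType) (a : A -> G) (rho : seq (seq A * seq A)),
    generates a S /\ presents a rho.

(** The universal property in the form in which it is used: a solution of the
    relations in K is a function of the element, not just of the word.  The
    values of [phi] away from the submonoid generated by [a] are junk. *)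
Lemma presents_extend (G : groupType) (A : eqType) (a : A -> G) rho :
  presents a rho -> forall (K : groupType) (k : A -> K), satisfies k rho ->
  exists phi : G -> K, forall u, phi (value a u) = value k u.
Proof.
move=> [_ pa] K k /pa h.
pose P g c := forall u, value a u = g -> value k u = c.
have /choice[phi hphi] : forall g, exists c, P g c.
  move=> g; have [[u <-]|no] := pselect (exists u, value a u = g).
    by exists (value k u) => v; apply: h.
  by exists 1 => u uE; case: no; exists u.
by exists phi => u; rewrite (hphi _ u erefl).
Qed.

(** Converse of [presents_extend]; compatibility with letters on the left
    propagates to words by induction. *)
Lemma presents_of_extend (G : groupType) (A : eqType) (a : A -> G) rho :
  satisfies a rho ->
  (forall (K : groupType) (k : A -> K), satisfies k rho ->
     exists2 phi : G -> K, phi 1 = 1 &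
       forall x u, phi (a x * value a u) = k x * phi (value a u)) ->
  presents a rho.
Proof.
move=> arho ext; split=> // K k /ext[phi phi1 phiM].
suff phiE u : phi (value a u) = value k u by move=> u v; rewrite -!phiE => ->.
by elim: u => [|x u IH]; rewrite ?value_nil // !value_cons phiM IH.
Qed.

Lemma generates_mul (G : groupType) (A : Type) (a : A -> G) (S : set G) :
  generates a S -> forall x y, S x -> S y -> S (x * y).
Proof.
move=> gS x y /gS[[|c u] // _ <-] /gS[v _ <-]; apply/gS.
by exists ((c :: u) ++ v); rewrite ?value_cat.
Qed.

Lemma generates_letter (G : groupType) (A : Type) (a : A -> G) (S : set G) :
  generates a S -> forall x, S (a x).
Proof. by move=> gS x; apply/gS; exists [:: x]; rewrite ?value1. Qed.

(** * Finite Green index inside a group *)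

(** The trace in the group of T with an identity adjoined.  The adjoined
    identity and that of the group act alike, so [green_equiv] agrees with the
    relation defined with an abstract identity, see [greenH_equiv]. *)
Definition with1 (G : groupType) (T : set G) : set G := fun g => T g \/ g = 1.

Definition green_equiv (G : groupType) (T : set G) (u v : G) : Prop :=
  [/\ exists2 t, with1 T t & u = v * t, exists2 t, with1 T t & v = u * t,
      exists2 t, with1 T t & u = t * v & exists2 t, with1 T t & v = t * u].

Definition green_reps (G : groupType) (S T : set G) (R : seq G) : Prop :=
  (forall r, r \in R -> S r /\ ~ T r) /\
  (forall u, S u -> ~ T u -> exists2 r, r \in R & green_equiv T u r).

Lemma seq_choice (I : eqType) (Y : Type) (y0 : Y) (s : seq I) (P : I -> Y -> Prop) :
  (forall i, i \in s -> exists y, P i y) ->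
  exists f : I -> Y, forall i, i \in s -> P i (f i).
Proof.
move=> h; have /choice[f hf] : forall i, exists y, i \in s -> P i y.
  by move=> i; case: (boolP (i \in s)) => [/h[y Py]|]; [exists y|exists y0].
by exists f.
Qed.

Section Subsemigroup.
Variables (G : groupType) (S T : set G).
Hypotheses (SM : forall x y, S x -> S y -> S (x * y))
  (TM : forall x y, T x -> T y -> T (x * y)) (TS : forall x, T x -> S x).

Lemma with1M x y : with1 T x -> with1 T y -> with1 T (x * y).
Proof.
move=> [Tx|->] [Ty|->]; rewrite ?mul1g ?mulg1; [left; exact: TM|left..|right] => //.
Qed.

Lemma with1Ml x y : with1 T x -> T y -> T (x * y).
Proof. by move=> [Tx|->] Ty; rewrite ?mul1g //; apply: TM. Qed.

Lemma with1Mr x y : T x -> with1 T y -> T (x * y).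
Proof. by move=> Tx [Ty|->]; rewrite ?mulg1 //; apply: TM. Qed.

Lemma with1S x : with1 T x -> with1 S x.
Proof. by move=> [/TS|]; [left|right]. Qed.

Lemma with1MS x y : S x -> with1 S y -> S (x * y).
Proof. by move=> Sx [Sy|->]; rewrite ?mulg1 //; apply: SM. Qed.

Lemma green_sym u v : green_equiv T u v -> green_equiv T v u.
Proof. by case. Qed.

Lemma green_trans v u w :
  green_equiv T u v -> green_equiv T v w -> green_equiv T u w.
Proof.
move=> [[p1 ? u1] [p2 ? v2] [p3 ? u3] [p4 ? v4]].
move=> [[q1 ? v1] [q2 ? w2] [q3 ? v3] [q4 ? w4]]; split.
- by exists (q1 * p1); [exact: with1M|rewrite mulgA -v1].
- by exists (p2 * q2); [exact: with1M|rewrite mulgA -v2].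
- by exists (p3 * q3); [exact: with1M|rewrite -mulgA -v3].
- by exists (q4 * p4); [exact: with1M|rewrite -mulgA -v4].
Qed.

Variable R : seq G.
Hypothesis SR : green_reps S T R.

(** The source of every use of finiteness of the index: long sequences outside
    [T] repeat a class. *)
Lemma green_pigeonhole (f : nat -> G) :
  (forall i, i <= size R -> S (f i) /\ ~ T (f i)) ->
  exists i j, i < j /\ green_equiv T (f i) (f j).
Proof.
move=> fST; have [_ hR] := SR.
have [r hr] : exists r : nat -> G, forall i, i \in iota 0 (size R).+1 ->
    r i \in R /\ green_equiv T (f i) (r i).
  apply: (seq_choice 1 (P := fun i c => c \in R /\ green_equiv T (f i) c)) => i.
  rewrite mem_iota /= add0n ltnS => /fST[Si Ti].
  by have [c cR fc] := hR _ Si Ti; exists c.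
have nuniq : ~~ uniq (map r (iota 0 (size R).+1)).
  apply/negP => /uniq_leq_size le.
  have : size (map r (iota 0 (size R).+1)) <= size R.
    by apply: le => c /mapP[i /hr[riR _] ->].
  by rewrite size_map size_iota ltnn.
have /(uniqPn 1)[i [j [ij jn eqr]]] := nuniq.
move: jn eqr; rewrite size_map size_iota => jn.
have lt_in := ltn_trans ij jn.
rewrite !(nth_map 0%N) ?size_iota // !nth_iota // !add0n => eqr.
have hf l : l < (size R).+1 -> green_equiv T (f l) (r l).
  by move=> ln; have [|] := hr l; rewrite ?mem_iota.
exists i, j; split=> //; apply: green_trans (hf i lt_in) _.
by rewrite eqr; apply/green_sym/hf.
Qed.

End Subsemigroup.

(** * Absorbing elements *)

Section Absorb.
Variables (G : groupType) (S T : set G) (R : seq G).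
Hypotheses (SM : forall x y, S x -> S y -> S (x * y))
  (TM : forall x y, T x -> T y -> T (x * y)) (TS : forall x, T x -> S x)
  (SR : green_reps S T R).

Lemma with1X t n : T t -> with1 T (t ^+ n).
Proof.
move=> Tt; elim: n => [|n IH]; first by right; rewrite expg0.
by rewrite expgS; left; apply: with1Mr.
Qed.

(** If [s t^i] and [s t^j] with [i < j] were in the same class, cancelling
    [s t^i] would put [t^-1] in [T] or make it equal to 1.  So among
    [s], [s t], ..., [s t^n], with [n] the number of classes, some element is in
    [T], hence so is the last; the same holds on the left, and [w = t^(n+1)]
    also takes care of [s = 1]. *)
Lemma nonunit_absorbs t : T t -> ~ T t^-1 ->
  exists2 w, T w & forall s, with1 S s -> T (s * w) /\ T (w * s).
Proof.
move=> Tt Ntv.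
have with1_tV : ~ with1 T t^-1.
  move=> [//|t1]; have {}t1 : t = 1 by apply: invg_inj; rewrite t1 invg1.
  by apply: Ntv; rewrite t1 invg1 -t1.
pose n := size R; exists (t ^+ n.+1).
  by rewrite expgS; apply: (with1Mr TM) => //; apply: with1X.
have right_ s : S s -> T (s * t ^+ n).
  move=> Ss; apply: contrapT => Nst.
  have [|i [j [ij [[p Tp hp] _ _ _]]]] :=
    green_pigeonhole TM SR (f := fun i => s * t ^+ i).
    move=> i; rewrite -[size R]/n => le_in; split.
      by apply: (with1MS SM) => //; apply/(with1S TS)/with1X.
    move=> Tsi; apply: Nst; rewrite -(subnKC le_in) expgnDr mulgA.
    by apply: (with1Mr TM) => //; apply: with1X.
  case: with1_tV; suff <- : t ^+ (j - i.+1) * p = t^-1.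
    by apply: (with1M TM) => //; apply: with1X.
  apply: (mulgI t); rewrite mulgV mulgA -expgS subnSK //.
  apply: (mulgI (s * t ^+ i)); rewrite mulg1 {2}hp mulgA; congr (_ * _).
  by rewrite -mulgA -expgnDr subnKC // ltnW.
have left_ s : S s -> T (t ^+ n * s).
  move=> Ss; apply: contrapT => Nst.
  have [|i [j [ij [_ _ [p Tp hp] _]]]] :=
    green_pigeonhole TM SR (f := fun i => t ^+ i * s).
    move=> i; rewrite -[size R]/n => le_in; split.
      by apply: (with1Ml SM) => //; apply/(with1S TS)/with1X.
    move=> Tsi; apply: Nst; rewrite -(subnK le_in) expgnDr -mulgA.
    by apply: (with1Ml TM) => //; apply: with1X.
  case: with1_tV; suff <- : p * t ^+ (j - i.+1) = t^-1.
    by apply: (with1M TM) => //; apply: with1X.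
  apply: (mulIg t); rewrite mulVg -mulgA -expgSr subnSK //.
  apply: (mulIg (t ^+ i * s)); rewrite mul1g {2}hp -mulgA; congr (_ * _).
  by rewrite mulgA -expgnDr subnK // ltnW.
move=> s [Ss|->]; last first.
  by rewrite mul1g mulg1; split; rewrite expgS; apply: (with1Mr TM) => //; apply: with1X.
split; first by rewrite expgSr mulgA; apply: TM; [apply: right_|].
by rewrite expgS -mulgA; apply: TM => //; apply: left_.
Qed.

End Absorb.

Section AbsorbPresentation.
Variables (G : groupType) (S T : set G) (R : seq G).
Hypotheses (SM : forall x y, S x -> S y -> S (x * y))
  (TS : forall x, T x -> S x).
Variable w : G.
Hypotheses (Tw : T w) (Sw : forall s, with1 S s -> T (s * w) /\ T (w * s)).

(** Evaluating [phi (w s w)] in two ways gives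
    [phi (s w) / phi w = (phi w)^-1 * phi (w s)]; the left factor of a product
    is then moved across with the second form and the right factor with the
    first. *)
Lemma fraction_morphism (K : groupType) (phi : G -> K) :
  (forall x y, T x -> T y -> phi (x * y) = phi x * phi y) ->
  forall x y, with1 S x -> with1 S y ->
  phi (x * y * w) / phi w = (phi (x * w) / phi w) * (phi (y * w) / phi w).
Proof.
move=> phiM x y Sx Sy; have [Txw Twx] := Sw Sx; have [Tyw Twy] := Sw Sy.
have conj s : with1 S s -> phi (s * w) / phi w = (phi w)^-1 * phi (w * s).
  move=> /Sw[Tsw Tws]; apply: (mulgI (phi w)); apply: (mulIg (phi w)).
  by rewrite mulVKg mulgA mulgVK -!phiM // mulgA.
have Sxy : with1 S (x * y) by apply: (with1M SM).
have [Txyw Twxy] := Sw Sxy.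
rewrite (conj x) // mulgA; congr (_ / _).
apply: (mulgI (phi w)); rewrite mulgA mulVKg -!phiM //; congr phi.
by rewrite !mulgA.
Qed.

Hypothesis RS : forall r, r \in R -> S r.
Hypothesis RT : forall s, S s -> ~ T s ->
  exists2 r, r \in R & exists2 t, with1 T t & s = r * t.

(** A representative [r] is added as a generator with the relation that spells
    [r w] in the generators of [T]; this forces its image to be the value at
    [r] of the extension by fractions. *)
Lemma finitely_presented_absorbing_up : finitely_presented T -> finitely_presented S.
Proof.
move=> [B [b [rho [gT pT]]]].
pose A : finType := (B + 'I_(size R))%type.
pose a (x : A) : G :=
  match x with inl y => b y | inr i => nth 1 R i end.
have aS x : S (a x).
  by case: x => [y|i]; [exact/TS/(generates_letter gT)|exact/RS/mem_nth].
have /(seq_choice [::] (s := enum 'I_(size R)))[beta hbeta] : forall i : 'I_(size R),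
    i \in enum 'I_(size R) -> exists u, value b u = nth 1 R i * w.
  move=> i _; have [|Tiw _] := Sw (s := nth 1 R i); first by left; exact/RS/mem_nth.
  by move: Tiw => /gT[u _ <-]; exists u.
have /gT[om _ omE] := Tw.
pose sigma : seq (seq A * seq A) := map (fun p => (map inl p.1, map inl p.2)) rho ++
  map (fun i => (inr i :: map inl om, map inl (beta i))) (enum 'I_(size R)).
exists A, a, sigma; split.
  move=> g; split=> [Sg|[u u0 <-]]; last exact: value_closed.
  have inT t : T t -> exists2 u : seq A, u <> [::] & value a u = t.
    move=> /gT[u u0 <-]; exists (map inl u); last by rewrite value_map.
    by case: u u0.
  have [/inT//|NTg] := pselect (T g).
  have [r rR [t Tt gE]] := RT Sg NTg.
  have [u uE] : exists u, value a u = t.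
    by case: Tt => [/inT[u _ <-]|->]; [exists u|exists [::]; rewrite value_nil].
  have rn : index r R < size R by rewrite index_mem.
  exists (inr (Ordinal rn) :: u) => //.
  by rewrite value_cons uE gE /= nth_index.
apply: presents_of_extend.
  apply/satisfies_cat; split; apply/satisfies_map.
    by move=> p prho /=; rewrite !value_map; apply: pT.1.
  by move=> i ie /=; rewrite value_cons !value_map omE hbeta.
move=> K k /satisfies_cat[/satisfies_map krho /satisfies_map kbeta].
have [|phi hphi] := presents_extend pT (k := k \o inl).
  by move=> p /krho /=; rewrite !value_map.
have phiM x y : T x -> T y -> phi (x * y) = phi x * phi y.
  by move=> /gT[u _ <-] /gT[v _ <-]; rewrite -value_cat !hphi value_cat.
pose psi g := phi (g * w) / phi w; exists psi; first by rewrite /psi mul1g mulgV.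
have psia x : psi (a x) = k x.
  rewrite /psi; case: x => [y|i] /=.
    rewrite phiM //; last exact: (generates_letter gT).
    by rewrite mulgK -(value1 b) hphi value1.
  have := kbeta i (mem_enum _ _); rewrite /= value_cons !value_map -!hphi.
  by rewrite hbeta ?mem_enum // omE => <-; rewrite mulgK.
move=> x u; rewrite {1}/psi fraction_morphism //; first by rewrite -/(psi _) psia.
  by left.
case: u => [|y u]; [by right; rewrite value_nil|left].
exact: value_closed.
Qed.

End AbsorbPresentation.

(** * Generating a subsemigroup of finite Green index *)

(** Letters equal to 1 but outside [T] are dropped from a word; if nothing is
    left then the product 1 lies in [T], which is why 1 is tried as a generator. *)
Lemma generates_of_seq (G : groupType) (T : set G) (D : seq G) :
  (forall x y, T x -> T y -> T (x * y)) ->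
  (forall t, T t -> exists2 u, (forall x, x \in u -> x \in D /\ with1 T x) &
     value id u = t) ->
  exists (B : finType) (b : B -> G), generates b T.
Proof.
move=> TM TD; pose E := [seq x <- 1 :: D | `[< T x >]].
have ET x : x \in E <-> x \in 1 :: D /\ T x.
  by rewrite mem_filter; split=> [/andP[/asboolP ? ?]|[-> /asboolP ->]].
exists 'I_(size E), (fun i : 'I_(size E) => nth 1 E i) => t.
split=> [Tt|[u u0 <-]]; last first.
  apply: value_closed => // i; have [] // := (ET (nth 1 E i)).1 (mem_nth _ (ltn_ord i)).
have word u : (forall x, x \in u -> x \in D /\ with1 T x) ->
    exists v, value (fun i : 'I_(size E) => nth 1 E i) v = value id u.
  elim: u => [|x u IH] uD; first by exists [::]; rewrite !value_nil.
  have [|v vE] := IH; first by move=> y yu; apply: uD; rewrite inE yu orbT.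
  have [xD [Tx|->]] := uD x (mem_head _ _); last first.
    by exists v; rewrite vE value_cons mul1g.
  have xE : index x E < size E by rewrite index_mem; apply/ET; rewrite inE xD orbT.
  by exists (Ordinal xE :: v); rewrite !value_cons vE /= nth_index // -index_mem.
have [u /word[v vE] uE] := TD t Tt; rewrite -uE -vE in Tt *.
case: v Tt {vE} => [|i v] Tt; last by exists (i :: v).
rewrite value_nil in Tt *.
have E1 : index 1 E < size E by rewrite index_mem; apply/ET; rewrite mem_head.
by exists [:: Ordinal E1]; rewrite // value1 /= nth_index // -index_mem.
Qed.

Section Generation.
Variables (G : groupType) (S T : set G) (R : seq G).
Hypotheses (TM : forall x y, T x -> T y -> T (x * y)) (TS : forall x, T x -> S x)
  (SR : green_reps S T R).
Variables (A : finType) (a : A -> G).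
Hypothesis gS : generates a S.

Let SM := generates_mul gS.

(** Reading a word from its last letter, the current suffix is kept in the form
    [r u] with [r] a representative; a new letter [x] rewrites [x r] as [r' c],
    and only finitely many [c] occur. *)
Lemma right_rewriting : exists2 C : seq G, (forall c, c \in C -> with1 T c) &
  forall s, S s -> exists2 r, r \in 1 :: R & exists2 u, {subset u <= C} &
    s = r * value id u.
Proof.
have splitP s : S s -> exists2 r, r \in 1 :: R & exists2 c, with1 T c & s = r * c.
  move=> Ss; have [Ts|/(SR.2 _ Ss)[r rR [[c Tc sE] _ _ _]]] := pselect (T s).
    by exists 1; rewrite ?mem_head //; exists s; [left|rewrite mul1g].
  by exists r; [rewrite inE rR orbT|exists c].
have LS r : r \in 1 :: R -> with1 S r.
  by rewrite inE => /predU1P[->|/SR.1[Sr _]]; [right|left].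
pose L := [seq (x, r) | x <- enum A, r <- 1 :: R].
have [p|f hf] := seq_choice (1, 1) (s := L)
  (P := fun p q => [/\ q.1 \in 1 :: R, with1 T q.2 & a p.1 * p.2 = q.1 * q.2]).
  move=> /allpairsP[[x r] [_ rL ->]] /=.
  have /splitP[r' r'L [c Tc E]] : S (a x * r).
    by apply: (with1MS SM); [exact: (generates_letter gS)|exact: LS].
  by exists (r', c).
exists [seq (f p).2 | p <- L] => [c /mapP[p /hf[_ Tc _] ->] //|s].
move=> /gS[u _ <-]; elim: u => [|x u [r rL [v vC uE]]].
  by exists 1; rewrite ?mem_head //; exists [::]; rewrite // !value_nil mulg1.
have xrL : (x, r) \in L by apply/allpairsP; exists (x, r); rewrite mem_enum.
have [r'L _ /= E] := hf _ xrL.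
exists (f (x, r)).1 => //; exists ((f (x, r)).2 :: v).
  by move=> y; rewrite inE => /predU1P[->|/vC//]; apply: map_f.
by rewrite !value_cons uE mulgA E mulgA.
Qed.

(** In [r u] given by [right_rewriting] the representative [r] is pushed to the
    right through [u], replacing [r c] by [d r'].  The relative L-class of the
    rest is unchanged, so a product in [T] cannot end with [r'] outside [T]:
    at some point [r c] itself lies in [T], and the remaining letters already
    do. *)
Lemma generation_sub : exists (B : finType) (b : B -> G), generates b T.
Proof.
have [C CT hC] := right_rewriting.
pose L := [seq (r, c) | r <- R, c <- C].
have [p|f hf] := seq_choice (1, 1) (s := L)
  (P := fun p q => T (p.1 * p.2) \/
    [/\ q.1 \in R, with1 T q.2, p.1 * p.2 = q.2 * q.1 &
        exists2 d, with1 T d & q.1 = d * (p.1 * p.2)]).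
  move=> /allpairsP[[r c] [rR cC ->]] /=.
  have [?|Nrc] := pselect (T (r * c)); first by exists (1, 1); left.
  have Src : S (r * c).
    by apply: (with1MS SM); [exact: (SR.1 _ rR).1|exact/(with1S TS)/CT].
  have [r' r'R [_ _ [d Td rcE] [d' Td' r'E]]] := SR.2 _ Src Nrc.
  by exists (r', d); right; split=> //; exists d'.
pose D := C ++ [seq p.1 * p.2 | p <- L] ++ [seq (f p).2 | p <- L].
have CD c : c \in C -> c \in D /\ with1 T c.
  by move=> cC; split; [rewrite mem_cat cC|exact: CT].
apply: (@generates_of_seq _ _ D) => // t Tt.
have left_rewriting v : {subset v <= C} -> forall r, r \in R ->
    T (r * value id v) ->
    exists2 u, (forall x, x \in u -> x \in D /\ with1 T x) &
      value id u = r * value id v.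
  elim: v => [|c v IH] vC r rR Trv.
    by rewrite value_nil mulg1 in Trv; have [] := SR.1 _ rR.
  have cC : c \in C by apply/vC/mem_head.
  have {}vC : {subset v <= C} by move=> y yv; apply: vC; rewrite inE yv orbT.
  have rcL : (r, c) \in L by apply/allpairsP; exists (r, c).
  rewrite value_cons mulgA in Trv *.
  have [/= Trc|/= [r'R Td rcE [d' Td' r'E]]] := hf _ rcL.
    exists (r * c :: v); last by rewrite value_cons.
    move=> y; rewrite inE => /predU1P[->|/vC/CD//]; split; last by left.
    rewrite !mem_cat; apply/orP; right; apply/orP; left.
    by apply/mapP; exists (r, c).
  have [//|//||u uD uE] := IH _ (f (r, c)).1.
    by rewrite r'E -mulgA; apply: (with1Ml TM).
  exists ((f (r, c)).2 :: u); last by rewrite value_cons uE mulgA -rcE.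
  move=> y; rewrite inE => /predU1P[->|/uD//]; split=> //.
  by rewrite !mem_cat; apply/orP; right; apply/orP; right; apply: map_f.
have [r] := hC _ (TS Tt); rewrite inE => /predU1P[->|rR] [u uC tE].
  by exists u => [x /uC/CD//|]; rewrite tE mul1g.
by rewrite tE in Tt *; apply: left_rewriting.
Qed.

End Generation.

(** * Descending to a subsemigroup with an absorbing element *)

Section AbsorbingDown.
Variables (G : groupType) (S T : set G) (w : G).
Hypotheses (TS : forall x, T x -> S x)
  (Sw : forall s, with1 S s -> T (s * w) /\ T (w * s)).
Variables (B : finType) (b : B -> G).
Hypothesis gT : generates b T.

(** The generator [x] of [S] is the fraction [(x w) w^-1] of elements of [T].
    The words [beta s] and [gamma s] spell [s w] and [w s] over the generators
    of [T].  The relations say that [gamma] and [beta] agree as fractions on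
    letters, that the fractions of the suffixes of the finitely many relevant
    words multiply correctly, and that a generator [y] of [T] is its own
    fraction. *)
Lemma finitely_presented_absorbing_down : finitely_presented S -> finitely_presented T.
Proof.
move=> [A [a [rho [gS pS]]]].
have SM := generates_mul gS.
have wordT t : T t -> exists u, value b u = t by move=> /gT[u _ <-]; exists u.
have /choice[beta betaE] : forall s, exists u, with1 S s -> value b u = s * w.
  move=> s; have [/Sw[/wordT[u uE] _]|] := pselect (with1 S s); first by exists u.
  by exists [::].
have /choice[gamma gammaE] : forall s, exists u, with1 S s -> value b u = w * s.
  move=> s; have [/Sw[_ /wordT[u uE]]|] := pselect (with1 S s); first by exists u.
  by exists [::].
have /choice[alpha alphaE] : forall y, exists u, value a u = b y.
  by move=> y; have /TS/gS[u _ uE] := generates_letter gT y; exists u.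
have aS u : with1 S (value a u).
  by case: u => [|x u]; [right; rewrite value_nil|left; apply/gS; exists (x :: u)].
have aS1 x : with1 S (a x) by rewrite -(value1 a).
pose om := beta 1; have omE : value b om = w by rewrite betaE ?mul1g //; right.
pose fix split_rels (u : seq A) : seq (seq B * seq B) :=
  if u is x :: v then
    (gamma (a x) ++ beta (value a v), om ++ beta (value a u)) :: split_rels v
  else [::].
pose sigma : seq (seq B * seq B) :=
  map (fun x => (gamma (a x) ++ om, om ++ beta (a x))) (enum A) ++
  flatten (map (fun p => split_rels p.1 ++ split_rels p.2) rho) ++
  flatten (map (fun y => (y :: om, beta (b y)) :: split_rels (alpha y)) (enum B)).
have split_sat u : satisfies b (split_rels u).
  elim: u => [//|x u IH] p; rewrite inE => /predU1P[->|/IH//] /=.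
  by rewrite !value_cat omE gammaE // !betaE // value_cons !mulgA.
exists B, b, sigma; split=> //; split.
  apply/satisfies_cat; split; first apply/satisfies_map.
    by move=> x _ /=; rewrite !value_cat omE gammaE // betaE // mulgA.
  apply/satisfies_cat; split.
    apply/satisfies_flatten => p _.
    by apply/satisfies_cat.
  apply/satisfies_flatten => y _ p.
  rewrite inE => /predU1P[->|/split_sat//] /=.
  rewrite value_cons omE betaE //; left; exact/TS/(generates_letter gT).
move=> K k /satisfies_cat[/satisfies_map kgamma].
move=> /satisfies_cat[/satisfies_flatten krho /satisfies_flatten kalpha].
(* the assignment of the generators of S induced by k *)
pose h x := value k (beta (a x)) / value k om.
have hE u : satisfies k (split_rels u) ->
    value h u = value k (beta (value a u)) / value k om.
  elim: u => [|x u IH] hu; first by rewrite !value_nil mulgV.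
  have /= := hu _ (mem_head _ _); rewrite !value_cat => E.
  rewrite value_cons IH; last by move=> p pu; apply: hu; rewrite inE pu orbT.
  have /= := kgamma x (mem_enum _ _); rewrite !value_cat => Ex.
  rewrite mulgA; congr (_ / _); apply: (mulgI (value k om)).
  by rewrite -E /h !mulgA -Ex mulgK.
have hrho : satisfies h rho.
  move=> p prho; have [/hE-> /hE->] := (satisfies_cat _ _ _).1 (krho p prho).
  by rewrite pS.1.
have halpha y : value h (alpha y) = k y.
  have hy := kalpha y (mem_enum _ _).
  rewrite hE; last by move=> p pu; apply: hy; rewrite inE pu orbT.
  by rewrite alphaE -(hy _ (mem_head _ _)) /= value_cons mulgK.
have red u : value k u = value h (flatten (map alpha u)).
  by rewrite value_flatten; apply: eq_value => y; rewrite halpha.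
move=> u v uv; rewrite !red; apply: pS.2 => //.
by rewrite !value_flatten -!(eq_value (fun y => esym (alphaE y))).
Qed.

End AbsorbingDown.

(** * Subgroups of finite index *)

(** Elements are numbered by the first representative equivalent to them; 1 is
    put first, so that its class receives the number 0. *)
Lemma class_index (G : groupType) (E : G -> G -> Prop) (S : set G) (R : seq G) :
  (forall x y z, E x y -> (E z x <-> E z y)) -> E 1 1 ->
  (forall s, S s -> exists2 r, r \in 1 :: R & E r s) ->
  exists idx : G -> 'I_(size R).+1,
    [/\ forall x y, E x y -> idx x = idx y,
        forall s, S s -> E (nth 1 (1 :: R) (idx s)) s & idx 1 = ord0].
Proof.
move=> Etrans E11 SR.
pose idx g : 'I_(size R).+1 := inord (find (fun r => `[< E r g >]) (1 :: R)).
exists idx; split=> [x y Exy|s /SR[r rR Ers]|].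
- by congr inord; apply: eq_find => r; apply: asbool_equiv_eq; apply: Etrans.
- have hp : has (fun r => `[< E r s >]) (1 :: R).
    by apply/hasP; exists r => //; apply/asboolP.
  have /asboolP := nth_find 1 hp; rewrite /idx inordK //.
  by rewrite -[(size R).+1]/(size (1 :: R)) -has_find.
- by apply: val_inj; rewrite /= /idx /= asboolT //= inordK.
Qed.

Section CosetUp.
Variables (G : groupType) (S T : set G) (R : seq G).
Hypotheses (SM : forall x y, S x -> S y -> S (x * y))
  (TM : forall x y, T x -> T y -> T (x * y)) (TS : forall x, T x -> S x)
  (T1 : T 1) (TV : forall t, T t -> T t^-1)
  (RS : forall r, r \in R -> S r)
  (RT : forall s, S s -> ~ T s ->
     exists2 r, r \in R & exists2 t, with1 T t & s = r * t).

(** Over left cosets [e i * T], the relations [a z * e i = e (j z i) * tau] push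
    every generator past a representative.  For a solution [k] of the relations
    of [T], with values [phi], the function [e i * t |-> k (e i) * phi t] is then
    compatible with left multiplication by generators; [e ord0 = 1] must be
    imposed on [k] for it to send 1 to 1. *)
Lemma finitely_presented_coset_up : finitely_presented T -> finitely_presented S.
Proof.
move=> [B [b [rho [gT pT]]]].
pose I := 'I_(size R).+1; pose e (i : I) := nth 1 (1 :: R) i.
have [x y z Txy|||idx [idxE idxP idx1]] := @class_index _
    (fun r g => T (r^-1 * g)) S R.
- have -> : z^-1 * y = z^-1 * x * (x^-1 * y) by rewrite -mulgA mulVKg.
  split=> [Tzx|Tzy]; first exact: TM.
  by rewrite -(mulgK (x^-1 * y) (z^-1 * x)); apply: TM => //; apply: TV.
- by rewrite mulVg.
- move=> s Ss; have [Ts|/(RT Ss)[r rR [t Tt ->]]] := pselect (T s).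
    by exists 1; rewrite ?mem_head // invg1 mul1g.
  by exists r; [rewrite inE rR orbT|rewrite mulKg; case: Tt => [//|->]].
have idxM g t : T t -> idx (g * t) = idx g.
  by move=> Tt; apply/esym/idxE; rewrite mulKg.
pose A : finType := (B + I)%type.
pose a (x : A) : G := match x with inl y => b y | inr i => e i end.
have eS i : S (e i).
  case: i => -[|i] hi; [exact: TS|apply: RS; exact: mem_nth].
have aS x : S (a x).
  by case: x => [y|i]; [exact/TS/(generates_letter gT)|exact: eS].
pose j z i := idx (a z * e i).
have /choice[tau tauE] : forall zi : A * I, exists u,
    value b u = (e (j zi.1 zi.2))^-1 * (a zi.1 * e zi.2).
  move=> [z i]; have /idxP/gT[u _ uE] : S (a z * e i) by apply: SM.
  by exists u.
pose rewrites : seq (seq A * seq A) :=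
  [seq ([:: zi.1; inr zi.2], inr (j zi.1 zi.2) :: map inl (tau zi)) |
     zi <- enum {: A * I}].
pose sigma : seq (seq A * seq A) :=
  map (fun p => (map inl p.1, map inl p.2)) rho ++ rewrites ++
  [:: ([:: inr ord0], [::])].
exists A, a, sigma; split.
  move=> g; split=> [Sg|[u u0 <-]]; last exact: value_closed.
  have /gT[u u0 uE] := idxP _ Sg.
  exists (inr (idx g) :: map inl u) => //.
  by rewrite value_cons value_map uE mulVKg.
apply: presents_of_extend.
  apply/satisfies_cat; split; first apply/satisfies_map.
    by move=> p prho /=; rewrite !value_map; apply: pT.1.
  apply/satisfies_cat; split; first apply/satisfies_map.
    move=> zi _ /=; rewrite !value_cons value_nil mulg1 value_map.
    by rewrite (tauE zi) mulVKg.
  by move=> p; rewrite inE => /eqP ->; rewrite /= value1 value_nil.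
move=> K k /satisfies_cat[/satisfies_map krho].
move=> /satisfies_cat[/satisfies_map ktau kone].
have [|phi hphi] := presents_extend pT (k := k \o inl).
  by move=> p /krho /=; rewrite !value_map.
have phiM x y : T x -> T y -> phi (x * y) = phi x * phi y.
  by move=> /gT[u _ <-] /gT[v _ <-]; rewrite -value_cat !hphi value_cat.
pose psi g := k (inr (idx g)) * phi ((e (idx g))^-1 * g); exists psi.
  have := kone _ (mem_head _ _); rewrite /= value1 value_nil.
  rewrite /psi idx1 => ->; rewrite /e /= invg1 !mul1g.
  by rewrite -(value_nil b) hphi value_nil.
move=> z u; set s := value a u.
have Ss : S s.
  by case: u @s => [|y u]; rewrite ?value_nil; [exact: TS|exact: value_closed].
set i := idx s; set t := (e i)^-1 * s; have Tt : T t by exact: idxP.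
have sE : s = e i * t by rewrite mulVKg.
have jE : idx (a z * s) = j z i by rewrite sE mulgA idxM.
have tauT : T (value b (tau (z, i))) by rewrite tauE; apply/idxP/SM.
have zsE : (e (j z i))^-1 * (a z * s) = value b (tau (z, i)) * t.
  by rewrite tauE /= sE !mulgA.
have := ktau (z, i) (mem_enum _ _).
rewrite /= !value_cons value_nil mulg1 value_map => kE.
by rewrite /psi jE zsE phiM // hphi mulgA -kE -/i -/t mulgA.
Qed.

End CosetUp.

(** * The group of permutations of a type *)

(** The inverse is part of the data, as [Y] may be infinite; it is determined by
    the function, see [sym_eq]. *)
Record sym (Y : Type) := Sym {
  sym_fun :> Y -> Y; sym_inv : Y -> Y;
  sym_funK : cancel sym_fun sym_inv; sym_invK : cancel sym_inv sym_fun }.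

Section Sym.
Variable Y : Type.

HB.instance Definition _ := gen_eqMixin (sym Y).
HB.instance Definition _ := gen_choiceMixin (sym Y).

Lemma sym_eq (p q : sym Y) : p =1 q -> p = q.
Proof.
case: p q => [f f' fK f'K] [g g' gK g'K] /= /funext fg; subst g.
have e : f' = g' by apply/funext => y; rewrite -{1}(g'K y) fK.
by subst g'; congr Sym; apply: Prop_irrelevance.
Qed.

Definition sym_one : sym Y := @Sym Y id id (fun=> erefl) (fun=> erefl).
(** Composition from left to right, so that words act on the right. *)
Definition sym_mul (p q : sym Y) : sym Y :=
  Sym (can_comp (sym_funK q) (sym_funK p)) (can_comp (sym_invK p) (sym_invK q)).
Definition sym_invg (p : sym Y) : sym Y := Sym (sym_invK p) (sym_funK p).

Fact sym_mulA : associative sym_mul.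
Proof. by move=> p q r; apply: sym_eq. Qed.
Fact sym_mul1g : left_id sym_one sym_mul.
Proof. by move=> p; apply: sym_eq. Qed.
Fact sym_mulg1 : right_id sym_one sym_mul.
Proof. by move=> p; apply: sym_eq. Qed.
Fact sym_mulVg : left_inverse sym_one sym_invg sym_mul.
Proof. by move=> p; apply: sym_eq => y /=; rewrite sym_invK. Qed.
Fact sym_mulgV : right_inverse sym_one sym_invg sym_mul.
Proof. by move=> p; apply: sym_eq => y /=; rewrite sym_funK. Qed.

HB.instance Definition _ :=
  isGroup.Build (sym Y) sym_mulA sym_mul1g sym_mulg1 sym_mulVg sym_mulgV.

End Sym.

(** * Descending to a subgroup of finite index *)

Section CosetDown.
Variables (G : groupType) (S T : set G) (R : seq G).
Hypotheses (SV : forall x, S x -> S x^-1)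
  (TM : forall x y, T x -> T y -> T (x * y)) (TS : forall x, T x -> S x)
  (T1 : T 1) (TV : forall t, T t -> T t^-1)
  (RS : forall r, r \in R -> S r)
  (RT : forall s, S s -> ~ T s ->
     exists2 r, r \in R & exists2 t, with1 T t & s = t * r).

(** Reidemeister-Schreier.  The generators are
    [b (i, x) = e i * a x * (e j)^-1] with [e j] the representative of the coset
    [T * e i * a x], and [tau g u] rewrites [u] over them along the cosets
    [T * g], [T * g * a x], and so on.  The relations are the rewritten relations
    of [S] at every coset, and the statements that [b y], spelled as a word of
    [S] and rewritten from the trivial coset, gives back [y].  They suffice: a
    solution [k] makes each [x] act on [G * K] by
    [(g, c) |-> (g * a x, c * k (idx g, x))], the relations of [S] hold for this
    action, and the image of [(1, 1)] under a word of [T] records its value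
    under [k]. *)
Lemma finitely_presented_coset_down : finitely_presented S -> finitely_presented T.
Proof.
move=> [A [a [rho [gS pS]]]]; have SM := generates_mul gS.
have aS x : S (a x) by exact: (generates_letter gS).
pose I := 'I_(size R).+1; pose e (i : I) := nth 1 (1 :: R) i.
have [x y z Txy|||idx [idxE idxP' idx1]] := @class_index _
    (fun r g => T (g * r^-1)) S R.
- have -> : y * z^-1 = y * x^-1 * (x * z^-1) by rewrite mulgA mulgVK.
  split=> [Tzx|Tzy]; first exact: TM.
  by rewrite -(mulKg (y * x^-1) (x * z^-1)); apply: TM => //; apply: TV.
- by rewrite mulgV.
- move=> s Ss; have [Ts|/(RT Ss)[r rR [t Tt ->]]] := pselect (T s).
    by exists 1; rewrite ?mem_head // invg1 mulg1.
  by exists r; [rewrite inE rR orbT|rewrite mulgK; case: Tt => [//|->]].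
have idxP s : S s -> T (s * (e (idx s))^-1) by exact: idxP'.
have idxM g t : T t -> idx (t * g) = idx g.
  by move=> Tt; apply/esym/idxE; rewrite mulgK.
have idxe g u : S g -> idx (e (idx g) * u) = idx (g * u).
  move=> Sg; rewrite -(idxM _ _ (idxP _ Sg)); congr idx.
  by rewrite -mulgA mulKg.
have eS i : S (e i).
  case: i => -[|i] hi; [exact: TS|apply: RS; exact: mem_nth].
pose B : finType := (I * A)%type.
pose b (y : B) := e y.1 * a y.2 * (e (idx (e y.1 * a y.2)))^-1.
have bT y : T (b y) by exact/idxP/SM.
pose fix tau g (u : seq A) : seq B :=
  if u is x :: v then (idx g, x) :: tau (g * a x) v else [::].
have tauE u : forall g, S g ->
    value b (tau g u) = e (idx g) * value a u * (e (idx (g * value a u)))^-1.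
  elim: u => [|x u IH] g Sg; first by rewrite !value_nil !mulg1 mulgV.
  rewrite !value_cons IH; last exact: SM.
  by rewrite /b /= idxe // !mulgA mulgVK.
have tau_idx u g h : idx g = idx h -> S g -> S h -> tau g u = tau h u.
  elim: u g h => //= x u IH g h gh Sg Sh; rewrite gh; congr (_ :: _).
  by apply: IH; rewrite -?(idxe g) -?(idxe h) ?gh //; apply: SM.
have tau_cat u v : forall g, tau g (u ++ v) = tau g u ++ tau (g * value a u) v.
  elim: u => [|x u IH] g /=; first by rewrite value_nil mulg1.
  by rewrite IH value_cons mulgA.
have S1 : S 1 by exact: TS.
have tau1 u : T (value a u) -> value b (tau 1 u) = value a u.
  move=> Tu; have := idxM 1 _ Tu; rewrite mulg1 idx1 tauE // mul1g idx1 => ->.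
  by rewrite /e /= invg1 mulg1 mul1g.
have /choice[alpha alphaE] : forall y, exists u, value a u = b y.
  by move=> y; have /TS/gS[u _ uE] := bT y; exists u.
pose sigma : seq (seq B * seq B) :=
  [seq (tau (e q.1) q.2.1, tau (e q.1) q.2.2) |
     q <- [seq (i, p) | i <- enum I, p <- rho]] ++
  [seq (tau 1 (alpha y), [:: y]) | y <- enum B].
exists B, b, sigma; split.
  move=> t; split=> [Tt|[u u0 <-]]; last exact: value_closed.
  have /gS[u u0 uE] := TS Tt; exists (tau 1 u); first by case: u u0 {uE}.
  by rewrite tau1 uE.
split.
  apply/satisfies_cat; split; apply/satisfies_map.
    by move=> _ /allpairsP[p [_ prho ->]] /=; rewrite !tauE // pS.1.
  by move=> y _ /=; rewrite value1 tau1 alphaE.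
move=> K k /satisfies_cat[/satisfies_map krho /satisfies_map kalpha].
(* Outside S the index of an element is meaningless, and the second
   coordinate is left alone. *)
pose h (g : G) x := if `[< S g >] then k (idx g, x) else 1.
have fK x : cancel (fun y : G * K => (y.1 * a x, y.2 * h y.1 x))
    (fun y => (y.1 * (a x)^-1, y.2 * (h (y.1 * (a x)^-1) x)^-1)).
  by move=> [g c] /=; rewrite !mulgK.
have f'K x : cancel
    (fun y : G * K => (y.1 * (a x)^-1, y.2 * (h (y.1 * (a x)^-1) x)^-1))
   (fun y => (y.1 * a x, y.2 * h y.1 x)).
  by move=> [g c] /=; rewrite !mulgVK.
pose act x : sym (G * K) := Sym (fK x) (f'K x).
have actE u : forall y, S y.1 ->
    value act u y = (y.1 * value a u, y.2 * value k (tau y.1 u)).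
  elim: u => [|x u IH] [g c] /= Sg; first by rewrite !value_nil /= !mulg1.
  rewrite value_cons [LHS]/= -/(value act u _).
  rewrite IH /=; last exact: SM.
  by rewrite !value_cons /h asboolT // !mulgA.
have actN u : forall y, ~ S y.1 -> value act u y = (y.1 * value a u, y.2).
  elim: u => [|x u IH] [g c] /= Sg; first by rewrite !value_nil /= !mulg1.
  rewrite value_cons [LHS]/= IH /=; last first.
    by move=> /SM/(_ (SV (aS x))); rewrite mulgK.
  by rewrite value_cons /h asboolF // mulg1 mulgA.
have act_rho : satisfies act rho.
  move=> p prho; apply: sym_eq => y; have [Sy|Ny] := pselect (S y.1); last first.
    by rewrite !actN // pS.1.
  rewrite !actE // pS.1 //; congr (_, _ * _).
  have iE : idx y.1 = idx (e (idx y.1)) by have := idxe _ 1 Sy; rewrite !mulg1.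
  rewrite !(tau_idx _ _ _ iE) //; apply: (krho (idx y.1, p)).
  by apply/allpairsP; exists (idx y.1, p); rewrite mem_enum.
have red u : value k u = value k (tau 1 (flatten (map alpha u))).
  elim: u => [//|y u IH]; rewrite /= tau_cat value_cat mul1g alphaE.
  rewrite (kalpha y) ?mem_enum //= value_cons value1 IH; congr (_ * value k _).
  by apply: tau_idx => //; [rewrite -(idxM 1 (b y)) ?mulg1|exact: TS].
have act1 u : (value act u (1, 1)).2 = value k (tau 1 u).
  by rewrite actE //= mul1g.
move=> u v uv; rewrite (red u) (red v) -!act1.
rewrite (pS.2 _ act act_rho _ (flatten (map alpha v))) //.
by rewrite !value_flatten -!(eq_value (fun y => esym (alphaE y))).
Qed.

End CosetDown.

(** * Finite Green index preserves finite presentability *)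

Section FiniteIndex.
Variables (G : groupType) (S T : set G) (R : seq G).
Hypotheses (SM : forall x y, S x -> S y -> S (x * y))
  (TM : forall x y, T x -> T y -> T (x * y)) (TS : forall x, T x -> S x)
  (SR : green_reps S T R).

(** Some positive power of [s] has its inverse in [S]: either a power lies in
    [T], or two powers are in the same class and a quotient of them lies in
    [T], up to 1. *)
Lemma inverse_closed (TV : forall t, T t -> T t^-1) (s : G) : S s -> S s^-1.
Proof.
move=> Ss; have SX n : with1 S (s ^+ n) by apply: with1X.
suff [n Sn] : exists n, S (s ^- n.+1).
  have -> : s^-1 = s ^+ n * s ^- n.+1 by rewrite expgS invgM mulVKg.
  exact: (with1Ml SM).
have [[n Tn]|no] := pselect (exists n, T (s ^+ n.+1)).
  by exists n; exact/TS/TV.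
have [i le|i [j [ij [[t Tt E] _ _ _]]]] :=
  green_pigeonhole TM SR (f := fun i => s ^+ i.+1).
  split=> [|Ti]; last by apply: no; exists i.
  by rewrite expgS; apply: (with1MS SM).
have tE : s ^- (j - i.+1).+1 = t.
  apply: (mulgI (s ^+ (j - i.+1).+1)); rewrite mulgV.
  apply: (mulgI (s ^+ i.+1)); rewrite mulg1 {1}E mulgA -expgnDr.
  by rewrite subnSK // addSn subnKC // ltnW.
exists (j - i.+1); case: Tt => [Tt|t1]; first by rewrite tE; exact: TS.
rewrite tE t1 -invg1 -t1 -tE invgK expgS; exact: (with1MS SM).
Qed.

Lemma finitely_presented_empty : (forall t, ~ T t) -> finitely_presented T.
Proof.
move=> T0; exists void, (@of_void G), [::]; split.
  by move=> t; split=> [/T0//|[[|[]]]].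
by split=> // K k _ [|[]] // [|[]].
Qed.

Lemma finitely_presented_1 : finitely_presented (fun g : G => g = 1).
Proof.
exists unit, (fun=> 1), [:: ([:: tt], [::])]; split.
  move=> g; split=> [->|[u _ <-]]; first by exists [:: tt]; rewrite ?value1.
  by elim: u => [|x u IH]; rewrite ?value_nil // value_cons IH mulg1.
split=> [p|K k h u v _].
  by rewrite inE => /eqP ->; rewrite /= value1 value_nil.
have {}h : k tt = 1 by have := h _ (mem_head _ _); rewrite /= value1 value_nil.
suff k1 w : value k w = 1 by rewrite !k1.
by elim: w => [|[] w IH]; rewrite ?value_nil // value_cons h IH mulg1.
Qed.

Lemma finitely_presented_green : finitely_presented S <-> finitely_presented T.
Proof.
have RS r : r \in R -> S r by move=> /SR.1[].
have RTr s : S s -> ~ T s ->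
    exists2 r, r \in R & exists2 t, with1 T t & s = r * t.
  by move=> Ss Ns; have [r rR [? _ _ _]] := SR.2 _ Ss Ns; exists r.
have RTl s : S s -> ~ T s ->
    exists2 r, r \in R & exists2 t, with1 T t & s = t * r.
  by move=> Ss Ns; have [r rR [_ _ ? _]] := SR.2 _ Ss Ns; exists r.
have [[t [Tt NTt]]|TV] := pselect (exists t, T t /\ ~ T t^-1).
  have [w Tw Sw] := nonunit_absorbs SM TM TS SR Tt NTt.
  split=> [pS|]; last exact: (finitely_presented_absorbing_up SM TS Tw Sw RS RTr).
  have [A [a [rho [gS _]]]] := pS.
  have [B [b gT]] := generation_sub TM TS SR gS.
  exact: (finitely_presented_absorbing_down TS Sw gT).
have {}TV t : T t -> T t^-1.
  by move=> Tt; apply: contrapT => Nt; apply: TV; exists t.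
have [[t Tt]|T0] := pselect (exists t, T t).
  have T1 : T 1 by rewrite -(mulgV t); apply: TM => //; apply: TV.
  split; last exact: (finitely_presented_coset_up SM TM TS T1 TV RS RTr).
  exact: (finitely_presented_coset_down (inverse_closed TV) TM TS T1 TV RS RTl).
(* With T empty the classes are singletons, so S is finite and the trivial
   subgroup has finite index in it. *)
have {}T0 t : ~ T t by move=> Tt; apply: T0; exists t.
split=> _; first exact: finitely_presented_empty.
have [[s Ss]|S0] := pselect (exists s, S s); last first.
  suff -> : S = T by exact: finitely_presented_empty.
  apply/funext => s; apply/propext; split=> [Ss|/T0//].
  by case: S0; exists s.
have S1 : S 1 by rewrite -(mulgV s); apply: SM => //; apply: inverse_closed.
apply: (finitely_presented_coset_up SM (T := fun g => g = 1) _ _ _ _ RS).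
- by move=> x y -> ->; rewrite mulg1.
- by move=> x ->.
- by [].
- by move=> x ->; rewrite invg1.
- move=> x Sx _; have [r rR [y [/T0//|->] ->]] := RTr _ Sx (T0 x).
  by exists r => //; exists 1 => //; right.
exact: finitely_presented_1.
Qed.

End FiniteIndex.

(** * Malcev congruences as kernels *)

Section Malcev.
Variable A : choiceType.
Implicit Types (u v w : word A) (rho : set (word A * word A)).

Definition cons_word (x : A) (s : seq A) : word A := @Word A (x :: s) isT.

Lemma word_morph_value (K : groupType) (h : word A -> K) :
  {morph h : u v / u * v} ->
  forall u, h u = value (fun x => h (cons_word x [::])) u.
Proof.
move=> hM [[//|x s] xs].
have -> : Word xs = cons_word x s by apply: val_inj.
elim: s x {xs} => [|y s IH] x; first by rewrite value1.
have -> : cons_word x (y :: s) = cons_word x [::] * cons_word y s.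
  exact: val_inj.
by rewrite hM IH [RHS]value_cons.
Qed.

(** A map from the free semigroup to a group is determined by its values on
    letters, and the quotient by its kernel embeds in the group. *)
Lemma malcevP (sigma : congruence (word A)) :
  malcev sigma <-> exists (K : groupType) (k : A -> K),
    forall u v, sigma u v <-> value k u = value k v.
Proof.
split=> [[K [f f_inj]]|[K [k kP]]].
  pose h u := f (quotient_proj sigma u).
  have hM : {morph h : u v / u * v}.
    by move=> u v; rewrite /h -gmulfM; congr (f _); apply: quotient_projM.
  exists K, (fun x => h (cons_word x [::])) => u v.
  rewrite -!(word_morph_value hM); split=> [/quotient_projP|/f_inj/quotient_projP//].
  by rewrite /h => ->.
pose phi (q : quotient_semigroup sigma) := value k (repr q).
have phiE u : phi (quotient_proj sigma u) = value k u.
  by apply/kP/quotient_projP; rewrite quotient_reprK.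
have phiM : {morph phi : p q / p * q}.
  by move=> p q; rewrite phiE; apply: value_cat.
pose H := isMultiplicative.Build _ _ phi phiM.
pose F : {multiplicative quotient_semigroup sigma -> K} := HB.pack phi H.
exists K, F => p q /kP/quotient_projP.
by rewrite !quotient_reprK.
Qed.

(** The hull is the intersection of the Malcev congruences containing [rho], and
    these are the kernels of the solutions of [rho] in groups. *)
Lemma malcev_hullP rho u v : malcev_hull rho u v <->
  forall (K : groupType) (k : A -> K),
    (forall p, rho p -> value k p.1 = value k p.2) -> value k u = value k v.
Proof.
split=> [huv K k krho|huv sigma [/malcevP[K [k kP]] sigma_rho]]; last first.
  by apply/kP/huv => p /sigma_rho/kP.
pose R (u v : word A) := value k u = value k v.
have RM x x' y y' : R x x' -> R y y' -> R (x * y) (x' * y').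
  by rewrite /R !value_cat => -> ->.
pose sigma := @Congruence (word A) R (fun=> erefl) (fun _ _ => @esym _ _ _)
  (fun _ _ _ => @etrans _ _ _ _) RM.
by apply: (huv sigma); split=> //; apply/malcevP; exists K, k.
Qed.

End Malcev.

(** Words of a free semigroup are nonempty, whereas [presents] speaks of all
    words; a common first letter bridges the two, by cancellation. *)
Lemma value_eq_cons (G K : groupType) (A : Type) (a : A -> G) (k : A -> K) u v :
  (forall x, value a (x :: u) = value a (x :: v) ->
     value k (x :: u) = value k (x :: v)) ->
  value a u = value a v -> value k u = value k v.
Proof.
move=> h uv.
have hx (x : A) : value k u = value k v.
  apply: (mulgI (k x)); rewrite -!value_cons; apply: h.
  by rewrite !value_cons uv.
by case: u v {h uv} hx => [|x u] [|y v] // hx; [apply: (hx y)|apply: (hx x)..].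
Qed.

(** * Translation to subsets of a group *)

Section Embedding.
Variables (S : semigroupType) (G : groupType) (f : S -> G).
Hypotheses (fM : {morph f : x y / x * y}) (f_inj : injective f).

(** From the left, the isomorphism provides the generators; from the right, the
    embedding [f] itself is what makes the kernel of evaluation a Malcev
    congruence, so that the hull does not exceed it on relations of [S]. *)
Lemma has_finite_malcev_presentationP :
  has_finite_malcev_presentation S <-> finitely_presented (range f).
Proof.
split=> [[A [rho [/finite_seqP[s rhoE] [h [h' hK h'K]]]]]|].
  pose F w := f (h (quotient_proj (malcev_hull rho) w)).
  have FM : {morph F : u v / u * v}.
    by move=> u v; rewrite /F -fM -gmulfM; congr (f (h _)); apply: quotient_projM.
  pose a x := F (cons_word x [::]); have aE (w : word A) : value a w = F w.
    by rewrite -(word_morph_value FM).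
  have hullP (u v : word A) : value a u = value a v <-> malcev_hull rho u v.
    rewrite !aE; split=> [/f_inj/(can_inj hK)/quotient_projP//|].
    by move=> /quotient_projP; rewrite /F => ->.
  exists A, a, [seq (letters p.1, letters p.2) | p <- s]; split.
    move=> g; split=> [[x _ <-]|[[|c u] // _ <-]]; last first.
      by rewrite (aE (cons_word c u)) /F; exists (h (quotient_proj _ (cons_word c u))).
    exists (repr (h' x)); first by case: (repr _) => -[].
    by rewrite aE /F quotient_reprK h'K.
  split=> [|K k krho u v].
    by apply/satisfies_map => p ps /=; apply/hullP => sigma [_]; apply; rewrite rhoE.
  apply: value_eq_cons => x /(hullP (cons_word x u) (cons_word x v))/malcev_hullP.
  apply=> p; rewrite rhoE /= => ps.
  exact: ((satisfies_map _ _ _).1 krho).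
move=> [A [a [rho [gS [arho pS]]]]].
pose rels : seq (word A * word A) :=
  [seq (cons_word q.1 q.2.1, cons_word q.1 q.2.2) |
     q <- [seq (x, p) | x <- enum A, p <- rho]].
exists A, [set` rels]%classic; split; first exact: finite_seq.
have hullP (u v : word A) :
    malcev_hull [set` rels]%classic u v <-> value a u = value a v.
  split=> [/malcev_hullP|uv]; last first.
    apply/malcev_hullP => K k krels; apply: pS uv => p prho.
    apply: (value_eq_cons (a := a)) (arho _ prho) => x _.
    apply: (krels (cons_word x p.1, cons_word x p.2)).
    apply/mapP; exists (x, p) => //.
    by apply/allpairsP; exists (x, p); rewrite mem_enum.
  apply=> _ /mapP[_ /allpairsP[[x p] [_ prho ->]] ->] /=.
  by rewrite !value_cons arho.
have /choice[g gE] : forall w : word A, exists x, f x = value a w.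
  move=> w; have [x _ <-] : range f (value a w); last by exists x.
  by apply/gS; exists w => //; case: w => -[].
pose h (q : quotient_semigroup (malcev_hull [set` rels]%classic)) := g (repr q).
have hE w : h (quotient_proj _ w) = g w.
  by apply: f_inj; rewrite !gE; apply/hullP/quotient_projP; rewrite quotient_reprK.
have hM : {morph h : p q / p * q}.
  move=> p q; rewrite hE; apply: f_inj.
  by rewrite fM !gE value_cat.
have h_inj : injective h.
  move=> p q pq; rewrite -(quotient_reprK p) -(quotient_reprK q).
  by apply/quotient_projP/hullP; rewrite -!gE -/(h p) pq.
have /choice[h' h'K] : forall x, exists q, h q = x.
  move=> x; have /gS[[|c u] // _ uE] : range f (f x) by exists x.
  exists (quotient_proj _ (cons_word c u)).
  by rewrite hE; apply: f_inj; rewrite gE.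
pose H := isMultiplicative.Build _ _ h hM.
pose hmul : {multiplicative quotient_semigroup (malcev_hull [set` rels]%classic) -> S} :=
  HB.pack h H.
exists hmul; exists h' => // q.
by apply: h_inj; rewrite h'K.
Qed.

Variable T : set S.
Hypothesis TM : forall x y, T x -> T y -> T (x * y).

Lemma greenR_mul u v : greenR T u v ->
  exists2 t, with1 (f @` T)%classic t & f u = f v * t.
Proof.
move=> uv; have : [set adj1_in v * t | t in adj1_set T]%classic (Some u).
  by rewrite -uv; exists None => //; right.
move=> [_ [[t Tt <-]|->]] [<-]; last by exists 1; rewrite ?mulg1 //; right.
by exists (f t); [left; exists t|rewrite fM].
Qed.

Lemma greenL_mul u v : greenL T u v ->
  exists2 t, with1 (f @` T)%classic t & f u = t * f v.
Proof.
move=> uv; have : [set t * adj1_in v | t in adj1_set T]%classic (Some u).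
  by rewrite -uv; exists None => //; right.
move=> [_ [[t Tt <-]|->]] [<-]; last by exists 1; rewrite ?mul1g //; right.
by exists (f t); [left; exists t|rewrite fM].
Qed.

Lemma greenH_equiv u v : greenH T u v -> green_equiv (f @` T)%classic (f u) (f v).
Proof.
by move=> [uRv uLv]; split; [exact: greenR_mul|exact/greenR_mul/esym|
  exact: greenL_mul|exact/greenL_mul/esym].
Qed.

Lemma finite_green_index_reps :
  finite_green_index T -> exists R, green_reps (range f) (f @` T)%classic R.
Proof.
move=> [_ [k outer_k _]].
have /finite_seqP[s sE] : finite_set (outer_greenH_classes T).
  by apply/finite_setP; exists k.
have classP C : C \in s <-> outer_greenH_classes T C by rewrite sE.
have notT u : (f @` T)%classic (f u) -> T u by move=> [t Tt /f_inj <-].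
have [C|rep repE] := seq_choice 1 (s := s)
    (P := fun C g => exists2 u, f u = g & C = greenH_class T u).
  by move=> /classP[[u ->] _]; exists (f u), u.
exists (map rep s); split=> [_ /mapP[C Cs ->]|_ [u _ <-] Nu].
  have [u <- CE] := repE _ Cs; split; first by exists u.
  by move=> /notT; have [_] := (classP C).1 Cs; rewrite CE; apply.
have us : greenH_class T u \in s.
  apply/classP; split=> [|v [uv _] Tv]; first by exists u.
  apply: Nu; have [t Tt ->] := greenR_mul uv.
  have [v' Tv' <-] : (f @` T)%classic (f v * t).
    apply: (with1Mr (T := (f @` T)%classic)) Tt; last by exists v.
    by move=> _ _ [x Tx <-] [y Ty <-]; exists (x * y); rewrite ?fM //; apply: TM.
  by exists v'.
have [v vE uv] := repE _ us; exists (rep (greenH_class T u)); first exact: map_f.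
by rewrite -vE; apply: greenH_equiv; rewrite -[greenH T u v]/(greenH_class T u v) uv.
Qed.

End Embedding.

Theorem theorem7p1 (S : semigroupType) (P : pred S) (T : subSemigroupType P)
    (hS : group_embeddable S) (hT : finite_green_index [set x | P x]%classic) :
  has_finite_malcev_presentation S <-> has_finite_malcev_presentation T.
Proof.
have [G [f f_inj]] := hS.
have fM : {morph f : x y / x * y} by exact: gmulfM.
have valT : range (f \o val : T -> G) = (f @` [set x | P x])%classic.
  apply/seteqP; split=> [_ [x _ <-]|_ [x Px <-]].
    by exists (val x) => //; apply: valP.
  by exists (Sub x Px) => //=; rewrite SubK.
have PM x y : P x -> P y -> P (x * y).
  by move=> Px Py; rewrite -(SubK T Px) -(SubK T Py) -valM; apply: valP.
have [R SR] := finite_green_index_reps fM f_inj PM hT.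
have S_iff := has_finite_malcev_presentationP fM f_inj.
have T_iff : has_finite_malcev_presentation T <->
    finitely_presented (range (f \o val : T -> G)).
  apply: has_finite_malcev_presentationP => [x y|x y /f_inj/val_inj//].
  by rewrite /= valM fM.
rewrite S_iff T_iff valT; apply: finitely_presented_green SR.
- by move=> _ _ [x _ <-] [y _ <-]; exists (x * y); rewrite ?fM.
- by move=> _ _ [x Px <-] [y Py <-]; exists (x * y); [exact: PM|rewrite fM].
- by move=> _ [x _ <-]; exists x.
Qed.
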